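(* Let $q=l^{2m}$, where $l$ is an odd prime and $m\ge 1$ is an integer. Then there exists a family of EAQECCs $Q_j$ with parameters $[[n_j,k_j,d_j;c_j]]_q$ such that $\lim_{j\to\infty}\frac{k_j}{n_j}>0$ and $\lim_{j\to\infty}\frac{d_j}{n_j}>0$.
   Context: An $[[n,k,d;c]]_q$ entanglement-assisted quantum error-correcting code (EAQECC) encodes $k$ logical qudits into $n$ physical qudits using $c$ copies of maximally entangled states pre-shared between sender and receiver. In standard terms: with $\mathcal{H}=\mathbb{C}^q$ and $\Phi=q^{-1/2}\sum_{i}|i\rangle|i\rangle\in\mathcal{H}\otimes\mathcal{H}$, it is a subspace $Q=\{(U\otimes I)(|\psi\rangle\otimes|0\rangle^{\otimes (n-k-c)}\otimes\Phi^{\otimes c}):\psi\in\mathcal{H}^{\otimes k}\}$ of $\mathcal{H}^{\otimes n}\otimes\mathcal{H}^{\otimes c}$, where $U$ is a unitary on the sender's $n$ qudits (the $k$ data qudits, the $n-k-c$ ancillas and the sender's halves of the $c$ pairs) and $I$ acts on the receiver's $c$ halves, such that, with $P$ the orthogonal projector onto $Q$, for every operator $E$ on $\mathcal{H}^{\otimes n}$ acting nontrivially on at most $d-1$ qudits there is a scalar $\lambda_E$ with $P(E\otimes I)P=\lambda_E P$. The family is indexed by integers $j\ge 0$. *)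

(* Defs.v *)
From HB Require Import structures.
From mathcomp Require Import all_boot all_order all_algebra.
From mathcomp Require Import all_classical all_reals all_analysis.
From mathcomp Require Export complex.

Set Implicit Arguments.
Unset Strict Implicit.
Unset Printing Implicit Defensive.

Import Order.TTheory GRing.Theory Num.Theory.
Local Open Scope ring_scope.

(* The computational basis of (C^q)^{\otimes I}, for a finite set I of qudits. *)
Notation word q I := {ffun I -> 'I_q}.

(* The Hilbert space over C with orthonormal basis B; v b is the amplitude of
   |b>, and H_A \otimes H_B is state R (A * B). *)
Notation state R B := {ffun B -> (R[i])^o}.

Section HilbertSpace.
Variable R : realType.

Definition inner (B : finType) (u v : state R B) : R[i] :=
  \sum_(b : B) (u b)^* * v b.

Definition unitary (B : finType) (U : 'End(state R B)) : Prop :=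
  (forall u v, inner (U u) (U v) = inner u v) /\ limg U = fullv.

Definition orthogonal_projector (B : finType)
    (Q : {vspace state R B}) (P : 'End(state R B)) : Prop :=
  (forall v, v \in Q -> P v = v) /\
  (forall v, (forall w, w \in Q -> inner w v = 0) -> P v = 0).

(* The operator E \otimes I on H_A \otimes H_B. *)
Definition op_tensor_id (A B : finType) (E : 'End(state R A))
    (v : state R (A * B)%type) : state R (A * B)%type :=
  [ffun ab => E [ffun a => v (a, ab.2)] ab.1].

End HilbertSpace.

Section Qudits.
Variables (R : realType) (q : nat).

Definition restrict (I : finType) (S : {set I}) (x : word q I) :
    word q {i | i \in S} := [ffun i => x (val i)].

(* glue s x is the word s on the qudits in S and x on the others. *)
Definition glue (I : finType) (S : {set I}) (s : word q {i | i \in S})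
    (x : word q I) : word q I :=
  [ffun i => if insub i is Some j then s j else x i].

(* E = F \otimes I, with F acting on the qudits in S and I on the others. *)
Definition supported_on (I : finType) (S : {set I})
    (E : 'End(state R (word q I))) : Prop :=
  exists F : 'End(state R (word q {i | i \in S})),
    forall v x, E v x = F [ffun s => v (glue s x)] (restrict S x).

Definition ket0 (a : 'I_q) : R[i] := (val a == 0%N)%:R.

(* Amplitudes of Phi = q^{-1/2} \sum_i |i>|i>. *)
Definition Phi (a b : 'I_q) : R[i] := (sqrtC q%:R)^-1 * (a == b)%:R.

(* The sender's n qudits are, in order, the k data qudits, the n-k-c ancillas
   and the sender's halves of the c pairs. *)
Section Layout.
Variables (n k c : nat) (e : (k + (n - k - c) + c)%N = n).

Definition data_qudit (i : 'I_k) : 'I_n :=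
  cast_ord e (lshift c (lshift (n - k - c)%N i)).

Definition ancilla (i : 'I_(n - k - c)) : 'I_n :=
  cast_ord e (lshift c (rshift k i)).

Definition sender_half (i : 'I_c) : 'I_n :=
  cast_ord e (rshift (k + (n - k - c))%N i).

(* |psi> \otimes |0>^{\otimes (n-k-c)} \otimes Phi^{\otimes c}, where xy.1 is the
   word of the sender's n qudits and xy.2 that of the receiver's c halves. *)
Definition initial_state (psi : state R (word q 'I_k)) :
    state R (word q 'I_n * word q 'I_c)%type :=
  [ffun xy : word q 'I_n * word q 'I_c =>
     psi [ffun i => xy.1 (data_qudit i)]
     * (\prod_(i < n - k - c) ket0 (xy.1 (ancilla i)))
     * (\prod_(i < c) Phi (xy.1 (sender_half i)) (xy.2 i))].

End Layout.

(* Q is an [[n, k, d; c]]_q code. The equation e amounts to k + c <= n. *)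
Definition is_EAQECC (n k d c : nat)
    (Q : {vspace state R (word q 'I_n * word q 'I_c)%type}) : Prop :=
  (exists (e : (k + (n - k - c) + c)%N = n)
          (U : 'End(state R (word q 'I_n))),
     unitary U /\
     forall v, v \in Q <->
       exists psi, v = op_tensor_id U (initial_state e psi)) /\
  (exists P : 'End(state R (word q 'I_n * word q 'I_c)%type),
     orthogonal_projector Q P /\
     forall (E : 'End(state R (word q 'I_n))) (S : {set 'I_n}),
       (#|S| < d)%N -> supported_on S E ->
       exists lambda : R[i],
         forall v, P (op_tensor_id E (P v)) = lambda *: P v).

End Qudits.

Arguments is_EAQECC {R q} n k d c Q.

(* Main.v *)
Require Import Defs.
From HB Require Import structures.
From mathcomp Require Import all_boot all_order all_algebra.
From mathcomp Require Import all_classical all_reals all_analysis.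
From mathcomp Require Import finfield zify ring.

(* Use maximal entanglement (no ancillas) and let the sender's unitary permute the
   basis words over the field F with q elements by x |-> x *m A, where
   A = [[1, X], [Y, 1 + Y X]] is invertible.  An error on a set S of fewer than d
   qudits then satisfies the Knill-Laflamme condition as soon as the row space of
   the upper half of A has no nonzero word of weight < d (only diagonal matrix
   elements survive on the code) and the lower half of A maps onto F^S (these
   elements do not depend on the encoded word).  For each nonzero vector of weight
   < d, either condition excludes at most a fraction q^-k of the possible X, resp.
   Y, so with n = 2k, k = 3d, a Gilbert-Varshamov count finds X and then Y:
   there are at most 2^n q^d = 64^d q^d < q^k such vectors because q >= 9. *)

Set Implicit Arguments.
Unset Strict Implicit.
Unset Printing Implicit Defensive.

Import Order.TTheory GRing.Theory Num.Theory.
Import numFieldNormedType.Exports.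
Local Open Scope ring_scope.

(** * Gilbert-Varshamov choice of the matrices *)

Section Counting.
Variable F : finFieldType.

Lemma exists_mulmx_eq1 (m : nat) (z : 'rV[F]_m) :
  z != 0 -> exists c : 'cV[F]_m, z *m c = 1%:M.
Proof.
case/rV0Pn => i zi; exists ((z 0 i)^-1 *: delta_mx i 0).
apply/matrixP => a b; rewrite !ord1 -scalemxAr !mxE (bigD1 i) //= big1 => [|j ji].
  by rewrite !mxE !eqxx addr0 mulr1 mulVf.
by rewrite !mxE (negPf ji) mulr0.
Qed.

(** Some column [c] has [z *m c = 1], so [z] recovers [u], and then [M] is known, from [M + c *m u].
    This embeds pairs of a solution and a row vector into the space of all matrices. *)
Lemma card_mulmx_eq (m n : nat) (z : 'rV[F]_m) (w : 'rV[F]_n) : z != 0 ->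
  (#|[set M : 'M[F]_(m, n) | z *m M == w]| * #|F| ^ n <= #|F| ^ (m * n))%N.
Proof.
move=> /exists_mulmx_eq1[c zc].
have cardV : #|{: 'rV[F]_n}| = (#|F| ^ n)%N by rewrite card_mx mul1n.
rewrite -card_mx -cardV -[X in (_ * X)%N]cardsT -cardsX.
rewrite -(@card_in_imset _ _ (fun Mu => Mu.1 + c *m Mu.2)) ?max_card //.
move=> [M u] [N v]; rewrite !inE /= !andbT => /eqP zM /eqP zN eMN.
have uv : u = v.
  have := congr1 (mulmx z) eMN.
  by rewrite !mulmxDr zM zN !mulmxA zc !mul1mx => /addrI.
by rewrite uv in eMN *; rewrite (addIr _ eMN).
Qed.

Lemma leq_card_bigcup (I T : finType) (P : pred I) (A : I -> {set T}) :
  (#|\bigcup_(i | P i) A i| <= \sum_(i | P i) #|A i|)%N.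
Proof.
elim/big_ind2: _ => [|a A' b B' Aa Bb|//]; first by rewrite cards0.
by rewrite (leq_trans (leq_card_setU _ _)) // leq_add.
Qed.

Definition wt n (a : 'rV[F]_n) : nat := #|[set i | a 0 i != 0]|.

Definition light n d : {set 'rV[F]_n} := [set a | (wt a < d)%N].

(** Union over the supports: at most [2 ^ n] sets, each carrying at most [#|F| ^ d] words. *)
Lemma card_light n d : (#|light n d| <= 2 ^ n * #|F| ^ d)%N.
Proof.
have F0 : (0 < #|F|)%N by apply/card_gt0P; exists 0.
apply: (@leq_trans #|\bigcup_(S : {set 'I_n} | (#|S| < d)%N)
    [set \row_i g i | g : {ffun 'I_n -> F} in pffun_on 0 S predT]|).
  apply/subset_leq_card/fintype.subsetP => a; rewrite inE => wa.
  apply/bigcupP; exists [set i | a 0 i != 0] => //.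
  apply/imsetP; exists [ffun i => a 0 i]; last by apply/rowP => i; rewrite mxE ffunE.
  apply/pffun_onP; split => //; apply/fintype.subsetP => i; by rewrite !inE !ffunE.
apply: (leq_trans (leq_card_bigcup _ _)).
apply: (@leq_trans (\sum_(S : {set 'I_n}) #|F| ^ d)%N).
  apply: (@leq_trans (\sum_(S : {set 'I_n} | (#|S| < d)%N) #|F| ^ d)%N).
    apply: leq_sum => S Sd; apply: (leq_trans (leq_imset_card _ _)).
    by rewrite card_pffun_on leq_pexp2l // ltnW.
  by rewrite [leqRHS](bigID (fun S : {set 'I_n} => #|S| < d)%N) leq_addr.
by rewrite sum_nat_const -cardsT -powersetT card_powerset cardsT card_ord.
Qed.

(** Union bound: each [a] in [D] excludes at most one matrix in [#|F| ^ n] if [z a != 0], and none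
    if [z a = 0]. *)
Lemma exists_avoiding (T : finType) (D : {set T}) m n
    (z : T -> 'rV[F]_m) (w : T -> 'rV[F]_n) :
  {in D, forall a, z a = 0 -> w a != 0} -> (#|D| < #|F| ^ n)%N ->
  exists M : 'M[F]_(m, n), {in D, forall a, z a *m M != w a}.
Proof.
move=> zw Dn; have F0 : (0 < #|F|)%N by apply/card_gt0P; exists 0.
pose bad a := [set M : 'M[F]_(m, n) | z a *m M == w a].
have bad_le a : a \in D -> (#|bad a| * #|F| ^ n <= #|F| ^ (m * n))%N.
  move=> aD; have [za0|] := eqVneq (z a) 0; last exact: card_mulmx_eq.
  rewrite eq_card0 // => M; rewrite !inE za0 mul0mx eq_sym.
  by apply/negbTE/zw.
have lt_bad : (#|\bigcup_(a in D) bad a| < #|{: 'M[F]_(m, n)}|)%N.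
  rewrite card_mx -(ltn_pmul2r (_ : 0 < #|F| ^ n)%N) ?expn_gt0 ?F0 //.
  apply: (@leq_ltn_trans (#|D| * #|F| ^ (m * n))%N); last first.
    by rewrite mulnC ltn_pmul2l // expn_gt0 F0.
  rewrite -[leqRHS]sum_nat_const.
  apply: (@leq_trans (\sum_(a in D) #|bad a| * #|F| ^ n)%N); last first.
    by apply: leq_sum => a; apply: bad_le.
  by rewrite -big_distrl leq_mul2r leq_card_bigcup orbT.
have [M Mbad] : exists M, M \notin \bigcup_(a in D) bad a.
  apply/existsP; rewrite -negb_forall; apply: contraL lt_bad => /forallP badT.
  by rewrite -leqNgt subset_leq_card //; apply/fintype.subsetP => M _; apply: badT.
exists M => a aD; apply: contra Mbad => zM.
by apply/bigcupP; exists a; rewrite ?inE.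
Qed.

(* For A = [[1, X], [Y, 1 + Y X]]: no light word lies in the row space of the upper
   half, and no light column vector b^T is annihilated by the lower half. *)
Lemma exists_matrices k d : (2 ^ (k + k) * #|F| ^ d < #|F| ^ k)%N ->
  exists X Y : 'M[F]_k,
   (forall a : 'rV[F]_(k + k), a != 0 -> (wt a < d)%N ->
      lsubmx a *m X != rsubmx a) /\
   (forall b : 'rV[F]_(k + k), b != 0 -> (wt b < d)%N ->
      (lsubmx b + rsubmx b *m X^T) *m Y^T != - rsubmx b).
Proof.
move=> kd; have lt_D : (#|light (k + k) d :\ 0%R| < #|F| ^ k)%N.
  by apply: leq_ltn_trans kd; apply: leq_trans (card_light _ _);
    rewrite subset_leq_card ?subsetDl.
have [|X XP] := exists_avoiding (z := lsubmx) (w := rsubmx) _ lt_D.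
  move=> a; rewrite !inE => /andP[a0 _] la; apply: contra a0 => /eqP ra.
  by rewrite -[a]hsubmxK la ra row_mx0.
(* For b = (l, r), the lower half of A times b^T is the transpose of (l + r X^T) B + r, with B the
   transpose of the lower left block. The matrix chosen here is B. *)
have [|Y YP] := exists_avoiding (z := fun b => lsubmx b + rsubmx b *m X^T)
    (w := fun b : 'rV_(k + k) => - rsubmx b) _ lt_D.
  move=> b; rewrite !inE oppr_eq0 => /andP[b0 _] lb; apply: contra b0 => /eqP rb.
  by move: lb; rewrite rb mul0mx addr0 => lb; rewrite -[b]hsubmxK lb rb row_mx0.
exists X, Y^T; split=> a a0 wa; first by apply: XP; rewrite !inE a0.
by rewrite trmxK; apply: YP; rewrite !inE a0.
Qed.

(** Duality: let [pi] project onto the coordinates in [S] and let [K] be the cokernel of [D *m pi].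
    The columns of [pi *m K] are supported on [S] and killed by [D], hence zero, so the row space of
    [D *m pi] contains that of [pi]. *)
Lemma mulmx_onto_coordinates m n (D : 'M[F]_(m, n)) (S : {set 'I_n}) :
  (forall b : 'rV_n, (forall i, i \notin S -> b 0 i = 0) -> b *m D^T = 0 -> b = 0) ->
  forall u : 'rV_n, exists r : 'rV_m, {in S, forall i, (r *m D) 0 i = u 0 i}.
Proof.
move=> D_inj u; pose pi : 'M[F]_n := diag_mx (\row_i (i \in S)%:R).
have piE (v : 'rV_n) i : (v *m pi) 0 i = v 0 i * (i \in S)%:R.
  by rewrite mul_mx_diag !mxE.
have : (u *m pi <= D *m pi)%MS.
  apply: (submx_trans (submxMl _ _)); rewrite submxE.
  set K := cokermx _; apply/eqP/matrixP => i j; rewrite [RHS]mxE.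
  have /rowP/(_ i) : (col j (pi *m K))^T = 0; last by rewrite !mxE.
  apply: D_inj => [i' i'S|].
    by rewrite mul_diag_mx !mxE (negPf i'S) mul0r.
  rewrite -trmx_mul colE 2!(mulmxA D) [D *m _ *m K]mulmx_coker.
  by rewrite mul0mx trmx0.
case/submxP => r er; exists r => i iS.
by have := congr1 (fun v : 'rV_n => v 0 i) er; rewrite mulmxA !piE iS !mulr1.
Qed.

(** * The encoding permutation of basis words *)

Section Words.
Variables (X : finType) (phi : F -> X) (phi' : X -> F).
Hypotheses (phiK : cancel phi phi') (phi'K : cancel phi' phi).

Definition word_row n (x : {ffun 'I_n -> X}) : 'rV[F]_n := \row_i phi' (x i).
Definition row_word n (a : 'rV[F]_n) : {ffun 'I_n -> X} := [ffun i => phi (a 0 i)].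

Lemma word_rowK n : cancel (@word_row n) (@row_word n).
Proof. by move=> x; apply/ffunP => i; rewrite ffunE mxE phi'K. Qed.

Lemma row_wordK n : cancel (@row_word n) (@word_row n).
Proof. by move=> a; apply/rowP => i; rewrite mxE ffunE phiK. Qed.

(** The map sends a data word p and a receiver's word y to p U + y D. Images with the same y differ
    by some (z, z M), which is not light unless z = 0. On [S], a change of p is compensated by a
    translation of y. *)
Lemma exists_encoding k d : (2 ^ (k + k) * #|F| ^ d < #|F| ^ k)%N ->
  exists f : {ffun 'I_k -> X} * {ffun 'I_k -> X} -> {ffun 'I_(k + k) -> X},
  [/\ injective f,
     forall p p' y, (#|[set i | f (p, y) i != f (p', y) i]| < d)%N -> p = p' &
     forall S : {set 'I_(k + k)}, (#|S| < d)%N -> forall p p',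
       exists2 tau, injective tau &
       forall y, {in S, forall i, f (p, y) i = f (p', tau y) i}].
Proof.
move=> /exists_matrices[M [N [M_dist N_dist]]].
pose U : 'M[F]_(k, k + k) := row_mx 1%:M M.
pose D : 'M[F]_(k, k + k) := row_mx N (1%:M + N *m M).
pose f py := row_word (word_row py.1 *m U + word_row py.2 *m D).
have phi_inj := can_inj phiK.
exists f; split.
- move=> [p y] [p' y'] /(can_inj (@row_wordK _)) /=.
  rewrite !mul_mx_row !add_row_mx !mulmx1 !mulmxDr !mulmx1 => /eq_row_mx[e1].
  (* The two blocks are x + z N and (x + z N) M + z: together they give z, and then the first gives
     x. *)
  have second x z : x *m M + (z + z *m (N *m M)) = (x + z *m N) *m M + z.
    by rewrite mulmxDl mulmxA addrCA addrC.
  rewrite !second e1 => /addrI e3.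
  move: e1; rewrite (can_inj (@word_rowK _) e3) => /addIr.
  by move/(can_inj (@word_rowK _)) ->.
- move=> p p' y lt_d; apply/(can_inj (@word_rowK _))/eqP; rewrite -subr_eq0.
  apply/negP => /negP z0; set z := _ - _ in z0.
  have zU0 : z *m U != 0.
    apply: contra z0 => /eqP; rewrite mul_mx_row mulmx1 -(@row_mx0 _ _ k k).
    by case/eq_row_mx => ->.
  have zUd : (wt (z *m U) < d)%N.
    apply: leq_ltn_trans lt_d; apply/subset_leq_card/fintype.subsetP => i.
    rewrite !inE; apply: contra; rewrite !ffunE => /eqP/phi_inj.
    by rewrite mulmxBl !mxE => /addIr ->; rewrite subrr.
  have := M_dist _ zU0 zUd.
  by rewrite mul_mx_row mulmx1 row_mxKl row_mxKr eqxx.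
- move=> S Sd p p'.
  (* On [S], r D equals (p - p') U, so adding r to y serves as [tau]. *)
  have [|r rE] := @mulmx_onto_coordinates _ _ D S _ (word_row p *m U - word_row p' *m U).
    move=> b bS bD; apply/eqP/negP => /negP b0.
    have b_light : (wt b < d)%N.
      apply: leq_ltn_trans Sd; apply/subset_leq_card/fintype.subsetP => i.
      by rewrite inE; apply: contraR => /bS ->.
    have /eqP := N_dist b b0 b_light; apply; apply/eqP; rewrite -addr_eq0.
    rewrite -[b]hsubmxK tr_row_mx mul_row_col linearD /= trmx1 trmx_mul in bD.
    by rewrite -bD mulmxDr mulmx1 mulmxDl mulmxA addrCA addrC.
  exists (fun y => row_word (word_row y + r)).
    by move=> y y' /(can_inj (@row_wordK _))/addIr/(can_inj (@word_rowK _)).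
  move=> y i iS; rewrite !ffunE /= row_wordK; congr phi.
  have addE (u v : 'rV[F]_(k + k)) : (u + v) 0 i = u 0 i + v 0 i by rewrite mxE.
  rewrite mulmxDl addrA [RHS]addE rE // -addE; congr (_ 0 i).
  by rewrite (addrC (word_row p' *m U)) addrACA subrr addr0 addrC.
Qed.
End Words.
End Counting.

(** * Basis permutations, the encoder and its adjoint *)

Section Operators.
Variable R : realType.

(** For bijective [g] this is the basis permutation |g x> -> |x>. *)
Definition pullback (B B' : finType) (g : B' -> B) (v : state R B) :
    state R B' := [ffun x => v (g x)].

Fact pullback_is_linear (B B' : finType) (g : B' -> B) :
  linear (pullback g).
Proof. by move=> a u v; apply/ffunP => x; rewrite !ffunE. Qed.
HB.instance Definition _ (B B' : finType) (g : B' -> B) :=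
  GRing.isLinear.Build _ _ _ _ (@pullback B B' g) (pullback_is_linear g).

Lemma unitary_pullback (B : finType) (g : B -> B) :
  injective g -> unitary (linfun (pullback g)).
Proof.
move=> g_inj; split=> [u v|].
  rewrite /inner [RHS](reindex_inj g_inj) /=.
  by apply: eq_bigr => x _; rewrite !lfunE !ffunE.
have [h gK hK] := injF_bij g_inj.
apply/vspaceP => v; rewrite memvf; apply/memv_imgP.
exists (pullback h v); rewrite ?memvf // lfunE.
by apply/ffunP => x; rewrite !ffunE gK.
Qed.

Variables P Y X : finType.
Variables (f : P * Y -> X) (f' : X -> P * Y).

(* Here f' is the inverse of f, y is the word of the receiver's halves and a is the
   amplitude of each |y>|y> in the pairs; decode is the adjoint of encode. *)
Definition encode (a : R[i]) (psi : state R P) : state R (X * Y)%type :=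
  [ffun xy => a * ((f' xy.1).2 == xy.2)%:R * psi (f' xy.1).1].

Fact encode_is_linear a : linear (encode a).
Proof.
by move=> b u v; apply/ffunP => x; rewrite !ffunE /= mulrDr scalerAr.
Qed.
HB.instance Definition _ a :=
  GRing.isLinear.Build _ _ _ _ (encode a) (encode_is_linear a).

Definition decode (a : R[i]) (v : state R (X * Y)%type) : state R P :=
  [ffun p => a * \sum_(y : Y) (v (f (p, y), y) : R[i])].

Fact decode_is_linear a : linear (decode a).
Proof.
move=> b u v; apply/ffunP => x; rewrite !ffunE /=.
under eq_bigr do rewrite !ffunE.
by rewrite big_split /= mulrDr -scaler_sumr scalerAr.
Qed.
HB.instance Definition _ a :=
  GRing.isLinear.Build _ _ _ _ (decode a) (decode_is_linear a).

Hypothesis fK : cancel f f'.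
Hypothesis f'K : cancel f' f.

Lemma encodeK (a : R[i]) : a ^+ 2 * #|Y|%:R = 1 ->
  cancel (encode a) (decode a).
Proof.
move=> a2 psi; apply/ffunP => p; rewrite !ffunE.
under eq_bigr do rewrite !ffunE /= fK /= eqxx mulr1.
rewrite sumr_const -[RHS]mul1r -a2 expr2.
have -> (b c : R[i]) N : a * (b * c *+ N) = a * b * N%:R * c => //.
by rewrite mulrnAr mulrA mulr_natr -mulrnAl.
Qed.

(** As [a] is real, the amplitude of [decode a v] at [p] is the inner product of the encoded basis
    vector |p> with [v]. *)
Lemma decode_orthogonal (a : R[i]) v : a^* = a ->
  (forall psi, inner (encode a psi) v = 0) -> decode a v = 0.
Proof.
move=> aR v0; apply/ffunP => p; rewrite !ffunE.
rewrite -[RHS](v0 [ffun p' => (p' == p)%:R]) /inner mulr_sumr.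
transitivity (\sum_(x : X) \sum_(y : Y) a * (v (x, y) *+ (x == f (p, y)))).
  rewrite exchange_big; apply: eq_bigr => y _.
  rewrite (bigD1 (f (p, y))) //= eqxx mulr1n big1 ?addr0 // => x /negPf ->.
  by rewrite mulr0n mulr0.
rewrite pair_bigA; apply: eq_bigr => -[x y] _; rewrite !ffunE /=.
have -> : (x == f (p, y)) = ((f' x).2 == y) && ((f' x).1 == p).
  by rewrite -(can2_eq f'K fK) -pair_eqE /pair_eq andbC.
rewrite !rmorphM /= !conjC_nat aR.
case: (f' x) => p' y' /=.
by case: (y' == y); case: (p' == p); rewrite /= ?mulr1 ?mul0r ?mulr0 ?mul0r.
Qed.

Lemma decode_op_encode (a : R[i]) (E : 'End(state R X)) psi p :
  decode a (op_tensor_id E (encode a psi)) p =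
  a * \sum_(y : Y) E [ffun x => encode a psi (x, y)] (f (p, y)).
Proof. by rewrite ffunE; under eq_bigr do rewrite ffunE. Qed.
End Operators.

(** * The Knill-Laflamme condition *)

Section Errors.
Variables (R : realType) (q : nat) (I : finType) (S : {set I}).

Lemma restrict_glue (s : word q {i | i \in S}) (x : word q I) :
  Defs.restrict S (Defs.glue s x) = s.
Proof. by apply/ffunP => i; rewrite !ffunE valK. Qed.

Lemma glue_restrict (x : word q I) : Defs.glue (Defs.restrict S x) x = x.
Proof. by apply/ffunP => i; rewrite !ffunE; case: insubP => // j _ <-; rewrite ffunE. Qed.

Lemma glueE_notin (s : word q {i | i \in S}) (x : word q I) i :
  i \notin S -> Defs.glue s x i = x i.
Proof. by move=> iS; rewrite !ffunE insubN. Qed.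

Variables P Y : finType.
Variables (f : P * Y -> word q I) (f' : word q I -> P * Y).
Hypothesis fK : cancel f f'.
Hypothesis f'K : cancel f' f.

(* By the first hypothesis on f only diagonal matrix elements of F contribute, and by
   the second their sum over y is the same for every p. *)
Lemma knill_laflamme (a : R[i]) (E : 'End(state R (word q I))) :
  supported_on S E ->
  (forall p p' y, (forall i, i \notin S -> f (p, y) i = f (p', y) i) -> p = p') ->
  (forall p p', exists2 tau : Y -> Y, injective tau &
     forall y, Defs.restrict S (f (p, y)) = Defs.restrict S (f (p', tau y))) ->
  exists lambda : R[i], forall psi,
    decode f a (op_tensor_id E (encode f' a psi)) = lambda *: psi.
Proof.
move=> [F EF] fS f_equi.
pose dl (t : word q {i | i \in S}) : state R _ := [ffun s => (s == t)%:R].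
pose diag p := \sum_(y : Y) F (dl (Defs.restrict S (f (p, y))))
                               (Defs.restrict S (f (p, y))) : R[i].
have diagE p p' : diag p = diag p'.
  have [tau tau_inj tauE] := f_equi p p'.
  rewrite /diag [RHS](reindex_inj tau_inj).
  by apply: eq_bigr => y _; rewrite tauE.
(* Once the receiver's word [y] and the letters of [f (p, y)] outside [S] are fixed, a single basis
   word of the encoded state remains. *)
have slice psi p y :
    [ffun s => [ffun x => encode f' a psi (x, y)] (Defs.glue s (f (p, y)))] =
    (a * psi p) *: dl (Defs.restrict S (f (p, y))).
  apply/ffunP => s; rewrite !ffunE /=.
  have [->|sN] := eqVneq s.
    by rewrite glue_restrict fK /= eqxx !mulr1; exact/esym/mulr1.
  have [e|_] := eqVneq; last by rewrite mulr0 mul0r scaler0.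
  case/eqP: sN; rewrite -[LHS](restrict_glue s (f (p, y))).
  set x := Defs.glue _ _ in e *; congr (Defs.restrict S _).
  rewrite -(f'K x) [f' x]surjective_pairing e.
  (* [x] is the image of [((f' x).1, y)] and agrees with [f (p, y)] outside [S], so [fS] identifies
     the data words. *)
  suff -> : (f' x).1 = p by [].
  apply: (fS _ _ y) => i iS.
  by rewrite -{1}e -surjective_pairing f'K glueE_notin.
have decodeE psi p : decode f a (op_tensor_id E (encode f' a psi)) p =
    a ^+ 2 * diag p * psi p.
  rewrite decode_op_encode mulr_sumr /diag mulr_sumr mulr_suml.
  apply: eq_bigr => y _; rewrite EF slice linearZ ffunE /=.
  rewrite /GRing.scale /=; set z := F _ _.
  by rewrite expr2 !mulrA mulrAC.
case: (pickP P) => [p0 _|P0].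
  exists (a ^+ 2 * diag p0) => psi; apply/ffunP => p.
  by rewrite decodeE (diagE p p0) ffunE.
(* With [P] empty the state space is zero and any scalar works. *)
by exists 0 => psi; apply/ffunP => p; have := P0 p.
Qed.
End Errors.

(** * From a permutation of words to a code *)

Section Construction.
Variables (R : realType) (q : nat).
Hypothesis q_gt0 : (0 < q)%N.

Definition Phi_amplitude c : R[i] := (sqrtC q%:R)^-1 ^+ c.

Lemma conj_Phi_amplitude c : (Phi_amplitude c)^* = Phi_amplitude c.
Proof.
by apply: conj_Creal; rewrite ger0_real // exprn_ge0 // invr_ge0 sqrtC_ge0 ler0n.
Qed.

Lemma Phi_amplitude_sqr c : Phi_amplitude c ^+ 2 * #|word q 'I_c|%:R = 1.
Proof.
rewrite card_ffun !card_ord natrX /Phi_amplitude exprAC -exprMn exprVn sqrtCK.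
by rewrite mulVf ?expr1n // pnatr_eq0 -lt0n.
Qed.

Lemma prod_Phi c (u v : word q 'I_c) :
  \prod_(i < c) Phi R (u i) (v i) = Phi_amplitude c * (u == v)%:R.
Proof.
rewrite big_split /= prodr_const card_ord; congr (_ * _).
have [->|uv] := eqVneq u v; first by rewrite big1 // => i _; rewrite eqxx.
have /existsP[i ui] : [exists i, u i != v i].
  by rewrite -negb_forall; apply: contra uv => /eqfunP/ffunP/eqP.
by rewrite (bigD1 i) //= (negPf ui) mul0r.
Qed.

(** The unitary sends |x> to |f (p, y)>, where p and y are the data letters and the sender's halves
    in x. The projector is [enc \o dec], since [dec] inverts [enc] and kills the orthogonal
    complement of the code. *)
Lemma exists_EAQECC k c d (f : word q 'I_k * word q 'I_c -> word q 'I_(k + c)) :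
  injective f ->
  (forall p p' y, (#|[set i | f (p, y) i != f (p', y) i]| < d)%N -> p = p') ->
  (forall S : {set 'I_(k + c)}, (#|S| < d)%N -> forall p p',
    exists2 tau : word q 'I_c -> word q 'I_c, injective tau &
     forall y, Defs.restrict S (f (p, y)) = Defs.restrict S (f (p', tau y))) ->
  exists Q : {vspace state R (word q 'I_(k + c) * word q 'I_c)%type},
    is_EAQECC (k + c) k d c Q.
Proof.
move=> f_inj f_dist f_equi.
have card_words : (#|word q 'I_(k + c)| = #|{: word q 'I_k * word q 'I_c}|)%N.
  by rewrite card_prod !card_ffun !card_ord expnD.
have no_ancilla : (k + c - k - c = 0)%N by rewrite addKn subnn.
have e : (k + (k + c - k - c) + c)%N = (k + c)%N by rewrite no_ancilla addn0.
have [f' fK f'K] : bijective f by apply: inj_card_bij; rewrite // card_words.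
pose h (x : word q 'I_(k + c)) : word q 'I_k * word q 'I_c :=
  ([ffun i => x (data_qudit e i)], [ffun i => x (sender_half e i)]).
have h_inj : injective h.
  move=> x x' [/ffunP xd /ffunP xs]; apply/ffunP => i.
  rewrite -(cast_ordKV e i); case: (split_ordP (cast_ord (esym e) i)) => j ->.
    case: (split_ordP j) => j' ->; first by have := xd j'; rewrite !ffunE.
    by case: j' => j' lt_j'; exfalso; rewrite no_ancilla in lt_j'.
  by have := xs j; rewrite !ffunE.
have [h' hK h'K] : bijective h by apply: inj_card_bij; rewrite // card_words.
pose g := h' \o f'.
have g_inj : injective g by apply: inj_comp; [apply: can_inj h'K|apply: can_inj f'K].
pose U := linfun (pullback (R := R) g).
pose enc : {linear state R _ -> state R _} := encode (R := R) f' (Phi_amplitude c).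
pose dec : {linear state R _ -> state R _} := decode (R := R) f (Phi_amplitude c).
have encE psi : op_tensor_id U (initial_state e psi) = enc psi.
  apply/ffunP => -[x y]; rewrite !ffunE lfunE !ffunE /=.
  have := h'K (f' x); rewrite -/(g x) => hg.
  have g_data i : g x (data_qudit e i) = (f' x).1 i by rewrite -hg ffunE.
  have g_sender i : g x (sender_half e i) = (f' x).2 i by rewrite -hg ffunE.
  rewrite (eq_bigr (fun i => Phi R ((f' x).2 i) (y i))) => [|i _]; last first.
    by rewrite g_sender.
  rewrite prod_Phi big1 ?mulr1 => [|[i lt_i] _]; last first.
    by exfalso; rewrite no_ancilla in lt_i.
  by rewrite mulrC; congr (_ * psi _); apply/ffunP => i; rewrite ffunE g_data.
have encK : cancel enc dec by apply: encodeK => //; exact: Phi_amplitude_sqr.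
exists (limg (linfun enc)); split.
  exists e, U; split; first exact: unitary_pullback.
  move=> v; split => [/memv_imgP[psi _ ->]|[psi ->]].
    by exists psi; rewrite encE lfunE.
  by rewrite encE; apply/memv_imgP; exists psi; rewrite ?memvf ?lfunE.
exists (linfun (enc \o dec)); split; last first.
  move=> E S Sd ES.
  have [|lambda decE] := knill_laflamme fK f'K (Phi_amplitude c) ES _ (f_equi S Sd).
    move=> p p' y eq_f; apply: (f_dist _ _ y); apply: leq_ltn_trans Sd.
    apply/subset_leq_card/fintype.subsetP => i; rewrite inE.
    by apply: contraR => iS; rewrite eq_f.
  (* P E P = enc (dec E enc) dec, and dec E enc is the scalar [lambda]. *)
  exists lambda => v; rewrite !lfunE /=.
  by rewrite [X in enc X = _]decE linearZ.
split=> [v /memv_imgP[psi _ ->]|v v_orth]; rewrite !lfunE /=.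
  by rewrite encK.
rewrite [X in enc X](decode_orthogonal fK f'K) ?linear0 //.
  exact: conj_Phi_amplitude.
move=> psi; apply: v_orth; apply/memv_imgP.
by exists psi; rewrite ?memvf ?lfunE.
Qed.
End Construction.

(** * Parameters and asymptotics *)

(** With s = j + 1 the sides are 64^s q^s and (q^2)^s q^s, and q^2 >= 81. *)
Lemma ball_bound q j : (9 <= q)%N ->
  (2 ^ (3 * j.+1 + 3 * j.+1) * q ^ j.+1 < q ^ (3 * j.+1))%N.
Proof.
move=> q9; have q0 : (0 < q)%N by apply: leq_trans q9.
rewrite -mulnDl [(3 + 3)%N]/= !expnM (expnSr q 2) expnMn ltn_pmul2r ?expn_gt0 ?q0 //.
by rewrite ltn_exp2r // (@leq_trans (9 ^ 2)) // leq_exp2r.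
Qed.

Lemma exists_EAQECC_distance (R : realType) (l m j : nat) :
  prime l -> odd l -> (1 <= m)%N ->
  let q := (l ^ (2 * m))%N in let k := (3 * j.+1)%N in
  exists Q : {vspace state R (word q 'I_(k + k) * word q 'I_k)%type},
    is_EAQECC (k + k) k j.+1 k Q.
Proof.
move=> l_prime l_odd m_ge1 q k.
have l3 : (3 <= l)%N by rewrite odd_gt2 // prime_gt1.
have q9 : (9 <= q)%N.
  rewrite (@leq_trans (l ^ 2)) ?(@leq_exp2r 3 l 2) // leq_pexp2l ?prime_gt0 //.
  by rewrite leq_pmulr.
have m2_gt0 : (0 < 2 * m)%N by rewrite muln_gt0.
have [F _ cardF] := PrimePowerField l_prime m2_gt0.
(* Enumerating the field of q elements identifies it with the alphabet ['I_q]. *)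
have [|||f [f_inj f_dist f_equi]] := @exists_encoding F 'I_q
    (fun x => cast_ord cardF (enum_rank x))
    (fun i => enum_val (cast_ord (esym cardF) i)) _ _ k j.+1.
- by move=> x; rewrite cast_ordK enum_rankK.
- by move=> x; rewrite enum_valK cast_ordKV.
- by rewrite cardF; exact: ball_bound.
apply: (exists_EAQECC _ _ f_inj f_dist) => [|S Sd p p']; first exact: leq_trans q9.
have [tau tau_inj tauE] := f_equi S Sd p p'.
exists tau => // y; apply/ffunP => i; rewrite !ffunE.
by apply: tauE; exact: valP.
Qed.

Local Open Scope classical_set_scope.

Theorem theorem5p11 (R : realType) (q l m : nat)
    (l_prime : prime l) (l_odd : odd l) (m_ge1 : (1 <= m)%N)
    (q_def : q = (l ^ (2 * m))%N) :
  exists (n k d c : nat -> nat)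
         (Q : forall j : nat,
            {vspace state R (word q 'I_(n j) * word q 'I_(c j))%type}),
    (forall j : nat, is_EAQECC (n j) (k j) (d j) (c j) (Q j)) /\
    (n j @[j --> \oo] --> \oo) /\
    (exists2 rate : R, 0 < rate &
       ((k j)%:R / (n j)%:R : R) @[j --> \oo] --> rate) /\
    (exists2 delta : R, 0 < delta &
       ((d j)%:R / (n j)%:R : R) @[j --> \oo] --> delta).
Proof.
pose k j := (3 * j.+1)%N.
have code j : exists Q : {vspace state R
    (word q 'I_(k j + k j) * word q 'I_(k j))%type},
    is_EAQECC (k j + k j) (k j) j.+1 (k j) Q.
  by rewrite q_def; exact: exists_EAQECC_distance.
(* Here n = 6 (j + 1), k = c = 3 (j + 1) and d = j + 1, so the two ratios are constantly 1/2 and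
   1/6. *)
exists (fun j => k j + k j)%N, k, S, k, (fun j => projT1 (cid (code j))).
split; first by move=> j; exact: projT2 (cid (code j)).
split.
  apply/cvgnyPge => A; near=> j.
  by rewrite (@leq_trans j) //; [near: j; exact: nbhs_infty_ge|rewrite /k; lia].
split.
  exists 2^-1; rewrite ?invr_gt0 //.
  rewrite (_ : (fun j => _) = cst 2^-1); first exact: cvg_cst.
  apply/funext => j; have j1 : j.+1%:R != 0 :> R by rewrite pnatr_eq0.
  by rewrite /cst /k natrD natrM; field.
exists 6^-1; rewrite ?invr_gt0 //.
rewrite (_ : (fun j => _) = cst 6^-1); first exact: cvg_cst.
apply/funext => j; have j1 : j.+1%:R != 0 :> R by rewrite pnatr_eq0.
by rewrite /cst /k natrD natrM; field.
Unshelve. all: by end_near.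
Qed.
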